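(* Any randomized one-pass streaming algorithm for convex hull that distinguishes between inputs $\mathcal{P}$ having $|\mathcal{CH}(\mathcal{P})| = O(1)$ and inputs $\mathcal{P}$ having $|\mathcal{CH}(\mathcal{P})| = \Omega(n)$ in $\mathbb{R}^2$, with probability $1-\rho$, uses $\Omega(n)$ bits of space.
   Context: The input $\mathcal{P}$ is a stream of points in $\mathbb{R}^2$, $n$ denotes the stream-length parameter (the number of points, up to constant factors), $\mathcal{CH}(\mathcal{P})$ is the convex hull of $\mathcal{P}$ and $|\mathcal{CH}(\mathcal{P})|$ is its number of vertices. This is a promise problem: every input is promised to be of one of the two types (hull size bounded by an absolute constant, or hull size at least a constant times $n$), and the algorithm must decide which one. A one-pass (insertion-only) streaming algorithm reads the points once in order and keeps only a memory state, whose size in bits is the space. The default error parameter is $\rho = \frac13$. *)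

(* Defs.v *)
From HB Require Import structures.
From mathcomp Require Import all_boot all_order all_algebra finmap.
From mathcomp Require Import all_classical all_reals all_analysis.

Set Implicit Arguments.
Unset Strict Implicit.
Unset Printing Implicit Defensive.

Import Order.TTheory GRing.Theory Num.Theory.

Local Open Scope classical_set_scope.
Local Open Scope ring_scope.
Local Open Scope convex_scope.

Definition convex_hull (R : numDomainType) (M : lmodType R)
    (A : set (convex_lmodType M)) : set (convex_lmodType M) :=
  smallest (@convex_set R M) A.

Definition extreme_points (R : numDomainType) (M : lmodType R)
    (K : set (convex_lmodType M)) : set (convex_lmodType M) :=
  [set x | K x /\ forall y z (k : {i01 R}), K y -> K z ->
    0 < k%:num -> k%:num < 1 -> y <| k |> z = x -> y = x /\ z = x].

(* The vertices of the polygon CH(P); [P] may contain repetitions. *)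
Definition hull_vertices (R : realType) (P : seq 'rV[R]_2) : set 'rV[R]_2 :=
  extreme_points (convex_hull [set` P]).

(* |CH(P)|. The set is finite by [hull_vertices_finite] below, so that
   [fset_set] does not take its default value. *)
Definition hull_size (R : realType) (P : seq 'rV[R]_2) : nat :=
  #|` fset_set (hull_vertices P)|%fset.

Lemma hull_vertices_sub (R : realType) (P : seq 'rV[R]_2) :
  hull_vertices P `<=` [set` P].
Proof.
move=> x [Hx xE]; apply: contrapT => xP.
suff /(_ x Hx) [] : convex_hull [set` P] `<=` convex_hull [set` P] `\ x.
  by move=> _ /(_ erefl).
apply: smallest_sub; last first.
  move=> y yP; split; first exact: sub_gen_smallest.
  by move=> yx; apply: xP; rewrite -yx.
apply/convex_setW => y z /set_mem[Hy yx] /set_mem[Hz zx] k k0 k1.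
apply/mem_set; split; last first.
  by move=> /(xE y z k Hy Hz k0 k1)[/yx].
by move=> A [cA PA]; apply/set_mem/cA; apply/mem_set; [apply: Hy|apply: Hz].
Qed.

Lemma hull_vertices_finite (R : realType) (P : seq 'rV[R]_2) :
  finite_set (hull_vertices P).
Proof. exact: sub_finite_set (@hull_vertices_sub R P) (finite_seq P). Qed.

(* Memory state reached from [m] after reading [P], the first element of [P]
   being at position [i] in the stream. *)
Fixpoint run (X M : Type) (step : nat -> M -> X -> M) (i : nat) (m : M)
    (P : seq X) : M :=
  if P is x :: P' then run step i.+1 (step i m x) P' else m.

(* A randomized one-pass algorithm on streams of elements of [X], with [s] bits
   of memory, as a probability distribution over deterministic ones. The random
   seed and the number of elements read so far are available at every step and
   are not charged to the memory; drawing fresh random bits at each step is thus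
   a special case. *)
Record streaming_algorithm (R : realType) (X : Type) (s : nat) := {
  seed_display : measure_display ;
  seed : measurableType seed_display ;
  seed_law : probability seed R ;
  init_state : seed -> s.-tuple bool ;
  update : seed -> nat -> s.-tuple bool -> X -> s.-tuple bool ;
  output : seed -> s.-tuple bool -> bool ;
  measurable_output : forall P : seq X,
    measurable [set w | output w (run (update w) 0%N (init_state w) P)]
}.

Definition answer (R : realType) (X : Type) (s : nat)
    (A : streaming_algorithm R X s) (w : seed A) (P : seq X) : bool :=
  output w (run (update w) 0%N (init_state w) P).

(* Promise problem on streams of [n] points: small hulls (at most [C] vertices)
   have to be answered [false] and large hulls (at least [c * n] vertices) have
   to be answered [true], each with probability at least [1 - rho]. *)
Definition distinguishes_hulls (R : realType) (s : nat)
    (A : streaming_algorithm R 'rV[R]_2 s) (rho : R) (n C : nat) (c : R) :=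
  forall P : seq 'rV[R]_2, size P = n ->
    ((hull_size P <= C)%N ->
       ((1 - rho)%:E <= seed_law A [set w : seed A | ~~ answer w P])%E) /\
    (c * n%:R <= (hull_size P)%:R ->
       ((1 - rho)%:E <= seed_law A [set w : seed A | answer w P])%E).

(* Main.v *)
Require Import Defs.
From mathcomp Require Import all_boot all_order all_algebra finmap ring lra.
From mathcomp Require Import all_classical all_reals all_analysis.
From mathcomp Require Import measurable_realfun.

Set Implicit Arguments.
Unset Strict Implicit.
Unset Printing Implicit Defensive.

Import Order.TTheory GRing.Theory Num.Theory.
Local Open Scope classical_set_scope.
Local Open Scope ring_scope.
Local Open Scope convex_scope.

(* Reduction from the communication problem INDEX. Alice holds a bit string
   [x] of length [m ~ (1 - c) n / 2] and streams, for each [i], the point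
   [(i, -i^2)] of a parabola if [x i] is false, or a point slightly below it if
   [x i] is true. Bob, who wants [x i], adds two far points that form with
   [(i, -i^2)] a triangle containing everything else Alice may have sent, and
   spends the remaining points on a convex arc inside this triangle, close to
   its apex. If the apex is present the hull is the triangle; if it was lowered,
   all the points of the arc are vertices. The memory state after Alice's points
   is thus a one-way message for INDEX. Fixing a seed that errs on at most a
   fraction [rho] of the pairs [(x, i)], a Chernoff-type count over the [2^s]
   messages gives [s >= kappa m] with [kappa] depending only on [rho]. *)

(** * Fixing a good seed, and the one-way lower bound for INDEX *)

Lemma run_cat (X M : Type) (step : nat -> M -> X -> M) i m (P Q : seq X) :
  run step i m (P ++ Q) = run step (i + size P) (run step i m P) Q.
Proof.
by elim: P i m => [|x P IH] i m /=; rewrite ?addn0// IH addSnnS.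
Qed.

(** Averaging over the seed: the expected number of events that occur is at most [rho * #|J|]. *)
Lemma exists_few_events (R : realType) d (T : measurableType d)
    (P : probability T R) (J : finType) (E : J -> set T) (rho : R) :
  0 <= rho -> (forall j, measurable (E j)) ->
  (forall j, (P (E j) <= rho%:E)%E) ->
  exists w : T, (\sum_(j : J) (w \in E j)%:R <= rho * #|J|%:R)%R.
Proof.
move=> rho0 mE PE; apply: contrapT => /forallNP noW.
set x := rho * #|J|%:R.
have x0 : 0 <= x by rewrite mulr_ge0.
have [_ xk] := andP (truncn_itv x0).
(* The number of events is an integer, so exceeding [x] means reaching [k > x]; this gap stays
   strict after integration. *)
set k := (Num.truncn x).+1 in xk.
have mf j : measurable_fun setT (EFin \o (\1_(E j) : T -> R)).
  by apply/measurable_EFinP; exact: measurable_indic.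
have cnt w : (k%:R%:E <= \sum_(j : J) (\1_(E j) w)%:E :> \bar R)%E.
  rewrite sumEFin lee_fin.
  have : x < \sum_(j : J) (w \in E j)%:R by rewrite ltNge; exact/negP/noW.
  rewrite (eq_bigr (fun j => \1_(E j) w))//.
  rewrite (eq_bigr (fun j => (w \in E j : nat)%:R)); last first.
    by move=> j _; rewrite indicE.
  by rewrite -natr_sum ler_nat -truncn_lt_nat.
have : (k%:R%:E <= \sum_(j : J) P (E j))%E.
  rewrite -[X in (X <= _)%E]mule1 -(@probability_setT _ _ _ P).
  rewrite -integral_cst//.
  under eq_bigr => j _ do rewrite -[E j]setIT -integral_indic//.
  rewrite -ge0_integral_sum//.
  apply: ge0_le_integral => //; first by move=> w _; rewrite lee_fin.
  by apply: emeasurable_sum => j; exact: mf.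
apply/negP; rewrite -ltNge; apply: le_lt_trans (_ : _ <= x%:E)%E _; last first.
  by rewrite lte_fin.
apply: le_trans (lee_sum _ (fun j _ => PE j)) _.
by rewrite sumEFin lee_fin sumr_const /x mulr_natr.
Qed.

(* Exponential moments of the number of errors: the sum over all [x] of
   [expR (- u * errors)] is at most [#|M| * (1 + expR (- u)) ^+ m], by summing
   over all messages instead of the one sent. *)
Lemma index_code_bound (R : realType) (m : nat) (M : finType)
    (msg : {ffun 'I_m -> bool} -> M) (dec : M -> 'I_m -> bool) (rho u : R) :
  0 <= u ->
  \sum_(j : {ffun 'I_m -> bool} * 'I_m)
     (dec (msg j.1) j.2 != j.1 j.2)%:R
    <= rho * #|{: {ffun 'I_m -> bool} * 'I_m}|%:R ->
  expR (((1 - expR (- u)) / 2 - u * rho) * m%:R) <= #|M|%:R.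
Proof.
move=> u0; set T := expR (- u).
have T0 : 0 < T by exact: expR_gt0.
pose err a (x : {ffun 'I_m -> bool}) : R := \sum_i (dec a i != x i)%:R.
rewrite card_prod card_ffun card_bool card_ord natrM natrX => errors.
have {}errors : \sum_x err (msg x) x <= rho * (2 ^+ m * m%:R).
  by rewrite pair_bigA.
have expErr a x :
    expR (- u * err a x) = \prod_i (if dec a i != x i then T else 1).
  rewrite mulr_sumr expR_sum; apply: eq_bigr => i _.
  by case: ifP => _; rewrite ?mulr1// mulr0 expR0.
have upper : \sum_x expR (- u * err (msg x) x) <= #|M|%:R * (1 + T) ^+ m.
  apply: (@le_trans _ _ (\sum_x \sum_a expR (- u * err a x))).
    apply: ler_sum => x _; rewrite (bigD1 (msg x))//= lerDl sumr_ge0//.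
  rewrite exchange_big/= (eq_bigr (fun=> (1 + T) ^+ m)).
    by rewrite sumr_const mulr_natl.
  (* For a fixed message the sum over [x] factors over the bits, each having one right value (weight
     [1]) and one wrong value (weight [T]). *)
  move=> a _; under eq_bigr do rewrite expErr.
  rewrite -(bigA_distr_bigA (fun i b => if dec a i != b then T else 1)).
  rewrite (eq_bigr (fun=> 1 + T)) ?prodr_const ?card_ord// => i _.
  by rewrite big_bool/=; case: (dec a i) => //=; rewrite addrC.
(* The tangent line of [expR] at the average replaces Jensen's inequality. *)
have lower : expR (- u * (rho * m%:R)) * 2 ^+ m
    <= \sum_x expR (- u * err (msg x) x).
  apply: (@le_trans _ _ (\sum_x (expR (- u * (rho * m%:R)) *
      (1 - u * (err (msg x) x - rho * m%:R))))); last first.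
    apply: ler_sum => x _.
    have -> : - u * err (msg x) x
       = - u * (rho * m%:R) + - (u * (err (msg x) x - rho * m%:R)) by ring.
    by rewrite expRD ler_pM2l ?expR_gt0// expR_ge1Dx.
  rewrite -mulr_sumr ler_pM2l ?expR_gt0// sumrB sumr_const.
  rewrite card_ffun card_bool card_ord natrX lerBrDr gerDl.
  rewrite -mulr_sumr sumrB sumr_const card_ffun card_bool card_ord.
  rewrite mulr_ge0_le0// subr_le0.
  by apply: le_trans errors _; rewrite -[leRHS]mulr_natr natrX mulrAC mulrA.
have key : (1 + T) / 2 <= expR (- ((1 - T) / 2)).
  by apply: le_trans (expR_ge1Dx _); lra.
have keym : (1 + T) ^+ m <= 2 ^+ m * expR (- ((1 - T) / 2)) ^+ m.
  rewrite -exprMn lerXn2r ?nnegrE ?mulr_ge0 ?expR_ge0//; first by lra.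
  by move: key; lra.
have {lower upper} : expR (- u * (rho * m%:R)) * 2 ^+ m
    <= #|M|%:R * (2 ^+ m * expR (- ((1 - T) / 2)) ^+ m).
  by apply: le_trans lower (le_trans upper _); rewrite ler_wpM2l.
rewrite [leRHS]mulrCA [leLHS]mulrC ler_pM2l ?exprn_gt0// -expRM_natr.
have -> : ((1 - T) / 2 - u * rho) * m%:R
  = - u * (rho * m%:R) - (- ((1 - T) / 2) * m%:R) by ring.
by rewrite expRB ler_pdivrMr ?expR_gt0.
Qed.

(** Positivity of the exponent of [index_code_bound] at [u = 1/2 - rho]. It amounts to
    [T < 1 - u + 2 u^2], which follows from [T <= 1 / (1 + u)] and [(1 + u) (1 - u + 2 u^2) = 1 +
    u^2 + 2 u^3]. *)
Lemma index_rate_gt0 (R : realType) (rho : R) : rho < 1 / 2 ->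
  0 < (1 - expR (- (1 / 2 - rho))) / 2 - (1 / 2 - rho) * rho.
Proof.
move=> rho2; have u0 : 0 < 1 / 2 - rho by lra.
set u := 1 / 2 - rho in u0 *; set T := expR (- u).
have T0 : 0 < T := expR_gt0 _.
have T1 : T * (1 + u) <= 1.
  by rewrite -[leRHS](expRxMexpNx_1 u) mulrC ler_pM2r// expR_ge1Dx.
have -> : rho = 1 / 2 - u by rewrite /u; lra.
have : T < 1 - u + 2 * u ^+ 2.
  rewrite -(ltr_pM2r (_ : 0 < 1 + u)); last by lra.
  apply: le_lt_trans T1 _.
  have := exprn_gt0 2 u0; have := exprn_gt0 3 u0; rewrite exprS; nra.
nra.
Qed.

(** * Convex hulls and counting their vertices *)

Lemma convex_convex_hull (R : numDomainType) (M : lmodType R)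
    (A : set (convex_lmodType M)) : convex_set (convex_hull A).
Proof.
move=> x y k /set_mem Hx /set_mem Hy; apply/mem_set => K [cK AK].
by apply/set_mem/cK; apply/mem_set; [exact: Hx|exact: Hy].
Qed.

Lemma convex_set_barycenter3 (R : realFieldType) (M : lmodType R)
    (K : set (convex_lmodType M)) (x y z : M) (a b c : R) :
  convex_set K -> K x -> K y -> K z ->
  0 <= a -> 0 <= b -> 0 <= c -> a + b + c = 1 ->
  K (a *: x + b *: y + c *: z).
Proof.
move=> cK /mem_set Kx /mem_set Ky /mem_set Kz a0 b0 c0 abc1.
have [bc0|bc_neq0] := eqVneq (b + c) 0.
  have [b00 c00] : b = 0 /\ c = 0 by split; lra.
  have -> : a = 1 by lra.
  by rewrite b00 c00 !scale0r !addr0 scale1r; exact/set_mem.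
have bc_gt0 : 0 < b + c by rewrite lt_neqAle eq_sym bc_neq0 addr_ge0.
have t0 : 0 <= b / (b + c) by rewrite divr_ge0// ltW.
have t1 : b / (b + c) <= 1 by rewrite ler_pdivrMr// mul1r lerDl.
have a1 : a <= 1 by lra.
have := cK x _ (Itv01 a0 a1) Kx (cK y z (Itv01 t0 t1) Ky Kz).
move/set_mem; congr K.
rewrite /conv/= /unstable.onem -addrA; congr (_ + _).
rewrite scalerDr !scalerA; congr (_ *: _ + _ *: _); last first.
  by rewrite (_ : 1 - a = b + c); [field|lra].
by rewrite (_ : 1 - a = b + c); [field|lra].
Qed.

(** The point [x] together with the open half-plane [f y < f x] forms a convex set containing [P],
    hence the hull; a proper combination involving a point of that half-plane stays in it, so it
    cannot equal [x]. *)
Lemma exposed_hull_vertex (R : realType) (P : seq 'rV[R]_2) (x : 'rV[R]_2)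
    (w : 'cV[R]_2) :
  x \in P -> (forall y, y \in P -> y != x -> (y *m w) 0 0 < (x *m w) 0 0) ->
  hull_vertices P x.
Proof.
move=> xP xmax; pose f (y : 'rV[R]_2) : R := (y *m w) 0 0.
pose K : set (convex_lmodType 'rV[R]_2) := [set y | y = x \/ f y < f x].
have fconv (y z : convex_lmodType 'rV[R]_2) (k : {i01 R}) :
    f (y <| k |> z) = k%:num * f y + (1 - k%:num) * f z.
  by rewrite /f /conv/= mulmxDl -!scalemxAl !mxE.
have fK y : K y -> f y <= f x by case=> [->|/ltW].
have fKlt (y z : convex_lmodType 'rV[R]_2) (k : {i01 R}) :
    0 < k%:num -> k%:num < 1 ->
    f y <= f x -> f z <= f x -> f y < f x \/ f z < f x ->
    f (y <| k |> z) < f x.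
  by move=> k0 k1 fy fz fyz; rewrite fconv; case: fyz => ?; nra.
have hullK : convex_hull [set` P] `<=` K.
  apply: smallest_sub; last first.
    move=> y /= yP; have [->|yx] := eqVneq y x; first by left.
    by right; apply: xmax.
  apply/convex_setW => y z /set_mem Ky /set_mem Kz k k0 k1; apply/mem_set.
  case: (Ky) => [yx|yx]; last first.
    by right; apply: fKlt => //; [exact: fK|exact: fK|left].
  case: (Kz) => [zx|zx]; last first.
    by right; apply: fKlt => //; [exact: fK|exact: fK|right].
  by left; rewrite yx zx convmm.
split; first exact: sub_gen_smallest.
move=> y z k /hullK Ky /hullK Kz k0 k1 yzx.
case: (Ky) => [yx|yx]; last first.
  have := fKlt y z k k0 k1 (fK _ Ky) (fK _ Kz) (or_introl yx).
  by rewrite yzx ltxx.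
case: (Kz) => [zx//|zx].
have := fKlt y z k k0 k1 (fK _ Ky) (fK _ Kz) (or_intror zx).
by rewrite yzx ltxx.
Qed.

Lemma hull_size_geq (R : realType) (P s : seq 'rV[R]_2) :
  uniq s -> (forall x, x \in s -> hull_vertices P x) ->
  (size s <= hull_size P)%N.
Proof.
move=> us sV; rewrite -(undup_id us) -card_fseq; apply: fsubset_leq_card.
apply/fsubsetP => x; rewrite in_fset_set; last exact: hull_vertices_finite.
by rewrite in_fset => xs; apply/mem_set; exact: sV.
Qed.

(** Both sequences have the same hull, and the vertices of the hull of [Q] lie in [Q]. *)
Lemma hull_size_leq (R : realType) (P Q : seq 'rV[R]_2) :
  {subset Q <= P} -> [set` P] `<=` convex_hull [set` Q] ->
  (hull_size P <= size Q)%N.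
Proof.
move=> QP PQ.
have hullE : convex_hull [set` P] = convex_hull [set` Q].
  apply/seteqP; split.
    by apply: smallest_sub => //; exact: convex_convex_hull.
  apply: smallest_sub; first exact: convex_convex_hull.
  by move=> x /= /QP xP; exact: sub_gen_smallest.
have -> : hull_size P = hull_size Q by rewrite /hull_size /hull_vertices hullE.
apply: leq_trans (size_undup Q); rewrite -card_fseq; apply: fsubset_leq_card.
apply/fsubsetP => x; rewrite in_fset_set; last exact: hull_vertices_finite.
by rewrite in_fset => xV; apply: hull_vertices_sub; exact: set_mem xV.
Qed.

(** * Plane coordinates and the streams of Alice and Bob *)

Definition point (R : realType) (t y : R) : 'rV[R]_2 :=
  \row_(j < 2) (if j == 0 then t else y).

Lemma point_fst_inj (R : realType) (t y t' y' : R) :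
  point t y = point t' y' -> t = t'.
Proof. by move=> /rowP/(_ 0); rewrite !mxE. Qed.

Lemma point_bary (R : realType) (a b c t y t' y' t'' y'' : R) :
  a *: point t y + b *: point t' y' + c *: point t'' y''
  = point (a * t + b * t' + c * t'') (a * y + b * y' + c * y'').
Proof. by apply/rowP => j; rewrite !mxE; case: ifP. Qed.

Lemma point_dot (R : realType) (t y a : R) :
  (point t y *m (point a 1)^T) 0 0 = y + a * t.
Proof.
by rewrite mxE big_ord_recl big_ord1 !mxE/= mulr1 addrC mulrC.
Qed.

Section index_streams.
Variables (R : realType) (m : nat).
Implicit Types (x : {ffun 'I_m -> bool}) (i : 'I_m).

Definition alice_point x i : 'rV[R]_2 :=
  point i%:R (- i%:R ^+ 2 - (x i)%:R).

Definition alice_stream x : seq 'rV[R]_2 :=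
  [seq alice_point x i | i <- enum 'I_m].

(** Chosen so that [(j - i)^2 + x j <= L] for all [i] and [j]. *)
Let L : R := m%:R ^+ 2 + 1.

(** With [d = t - i] and [h = y + 2 i t - i^2], the two base vertices are [(d, h) = (- L, - L)] and
    [(L, - L)]. *)
Definition base_left i : 'rV[R]_2 :=
  point (i%:R - L) (2 * i%:R * L - i%:R ^+ 2 - L).

Definition base_right i : 'rV[R]_2 :=
  point (i%:R + L) (- 2 * i%:R * L - i%:R ^+ 2 - L).

(* Any sequence of pairwise distinct offsets in [(0, 1/2)] would do for
   [k.+3^-1]; on the parabola [y = -t^2 - 1/4] the arc then stays below the
   sides of the triangle. *)
Definition arc_abscissa i (k : nat) : R := i%:R + k.+3%:R^-1.

Definition arc_point i (k : nat) : 'rV[R]_2 :=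
  point (arc_abscissa i k) (- arc_abscissa i k ^+ 2 - 1 / 4).

Definition bob_stream N i : seq 'rV[R]_2 :=
  base_left i :: base_right i :: [seq arc_point i k | k <- iota 0 N].

Lemma size_alice_stream x : size (alice_stream x) = m.
Proof. by rewrite size_map size_enum_ord. Qed.

Lemma size_bob_stream N i : size (bob_stream N i) = N.+2.
Proof. by rewrite /= size_map size_iota. Qed.

Lemma mem_streamP x i N z :
  z \in alice_stream x ++ bob_stream N i ->
  [\/ exists j : 'I_m, z = alice_point x j, z = base_left i,
      z = base_right i | exists k : nat, z = arc_point i k].
Proof.
rewrite mem_cat !inE => /or4P[/mapP[j _ ->]|/eqP->|/eqP->|/mapP[k _ ->]].
- by apply: Or41; exists j.
- exact: Or42.
- exact: Or43.
- by apply: Or44; exists k.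
Qed.

Let L_gt0 : 0 < L.
Proof. by rewrite ltr_wpDl// exprn_ge0. Qed.

Let dist_le (i j : 'I_m) : (j%:R - i%:R) ^+ 2 <= m%:R ^+ 2 :> R.
Proof.
have hi : i%:R <= m%:R :> R by rewrite ler_nat ltnW.
have hj : j%:R <= m%:R :> R by rewrite ler_nat ltnW.
have := ler0n R i; have := ler0n R j; nra.
Qed.

Let dist_ge (i j : 'I_m) : j != i ->
  1 <= (j%:R : R) - i%:R \/ (j%:R : R) - i%:R <= - 1.
Proof.
rewrite -val_eqE neq_ltn => /orP[ji|ij]; [right|left].
  by move: ji; rewrite -(ler_nat R) -natr1; lra.
by move: ij; rewrite -(ler_nat R) -natr1; lra.
Qed.

Let arc_bounds k : 0 < (k.+3%:R^-1 : R) <= 1 / 3.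
Proof.
by rewrite invr_gt0 ltr0n/= mul1r lef_pV2 ?posrE ?ltr0n ?ler_nat.
Qed.

(* In the sheared coordinates [d = t - i], [h = y + 2 i t - i^2] centred at
   [(i, -i^2)], the triangle is [- L <= h <= - |d|]. *)
Lemma in_triangle i (A : set 'rV[R]_2) (t y : R) :
  A (point i%:R (- i%:R ^+ 2)) -> A (base_left i) -> A (base_right i) ->
  let d := t - i%:R in let h := y + 2 * i%:R * t - i%:R ^+ 2 in
  - L <= h -> h <= d -> h <= - d ->
  convex_hull (A : set (convex_lmodType 'rV[R]_2)) (point t y).
Proof.
move=> Ap Al Ar d h hL hd hd'.
(* Barycentric coordinates of [(d, h)]: each weight is nonnegative exactly on the inner side of one
   edge. *)
have := @convex_set_barycenter3 R _ _ (point i%:R (- i%:R ^+ 2))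
  (base_left i) (base_right i) (1 + h / L) ((- h - d) / (2 * L))
  ((d - h) / (2 * L)) (@convex_convex_hull _ _ A).
have LN : L != 0 by rewrite gt_eqF.
have -> : point t y = (1 + h / L) *: point i%:R (- i%:R ^+ 2)
  + ((- h - d) / (2 * L)) *: base_left i + ((d - h) / (2 * L)) *: base_right i.
  by rewrite point_bary /h /d; congr point; field.
apply.
- exact: sub_gen_smallest.
- exact: sub_gen_smallest.
- exact: sub_gen_smallest.
- by rewrite -lerBlDl sub0r lerNl -mulNr ler_pdivrMr//; lra.
- by rewrite divr_ge0 ?mulr_ge0 ?(ltW L_gt0)//; lra.
- by rewrite divr_ge0 ?mulr_ge0 ?(ltW L_gt0)//; lra.
- by field.
Qed.

Lemma hull_size_small x i N : x i = false ->
  (hull_size (alice_stream x ++ bob_stream N i) <= 3)%N.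
Proof.
move=> xi.
have piE : alice_point x i = point i%:R (- i%:R ^+ 2).
  by rewrite /alice_point xi subr0.
apply: (@hull_size_leq _ _ [:: alice_point x i; base_left i; base_right i]).
  move=> z; rewrite !inE mem_cat !inE => /or3P[/eqP->|->|->].
  - by rewrite map_f ?mem_enum.
  - by rewrite orbT.
  - by rewrite !orbT.
have hull_tri (t y : R) : let d := t - i%:R in
    let h := y + 2 * i%:R * t - i%:R ^+ 2 in
    - L <= h -> h <= d -> h <= - d ->
    convex_hull [set` [:: alice_point x i; base_left i; base_right i]]
      (point t y).
  by apply: in_triangle; rewrite /= -?piE !inE eqxx ?orbT.
move=> z /= /mem_streamP[[j ->]|->|->|[k ->]].
- have [->|ji] := eqVneq j i.
    by apply: sub_gen_smallest; rewrite /= inE eqxx.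
  have xj : 0 <= ((x j)%:R : R) <= 1.
    by case: (x j); rewrite /= ?lexx ?ler01.
  have := dist_le i j; rewrite /alice_point.
  (* Here [d = j - i] and [h = - d^2 - x j]; as [d] is a nonzero integer, [d^2 >= |d|]. *)
  by case: (dist_ge ji) => ? ?; apply: hull_tri; rewrite /L; nra.
- by apply: sub_gen_smallest; rewrite /= !inE eqxx orbT.
- by apply: sub_gen_smallest; rewrite /= !inE eqxx !orbT.
(* Here [d = e] and [h = - e^2 - 1/4], so [h <= - d] reads [(e - 1/2)^2 >= 0]. *)
have := arc_bounds k; rewrite /arc_point /arc_abscissa.
set e := _^-1 => e01; have L1 : 1 <= L by rewrite lerDr exprn_ge0.
by apply: hull_tri; nra.
Qed.

Lemma arc_point_inj i : injective (arc_point i).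
Proof.
move=> k l /point_fst_inj/addrI/invr_inj/eqP; rewrite eqr_nat.
by move=> /eqP[].
Qed.

Lemma hull_size_large x i N : x i = true ->
  (N <= hull_size (alice_stream x ++ bob_stream N i))%N.
Proof.
move=> xi.
rewrite -[leqLHS](size_iota 0) -(size_map (arc_point i)).
apply: hull_size_geq => [|_ /mapP[k kN ->]].
  by rewrite map_inj_uniq ?iota_uniq//; exact: arc_point_inj.
(* The tangent of [y = -t^2 - 1/4] at the arc point supports the hull there. *)
apply: (@exposed_hull_vertex _ _ _ (point (2 * arc_abscissa i k) 1)^T).
  by rewrite mem_cat !inE map_f ?orbT.
have L1 : 1 <= L by rewrite lerDr exprn_ge0.
move=> z /mem_streamP[[j ->] _|-> _|-> _|[l ->] lk]; rewrite !point_dot.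
(* The gap to be shown positive is [(j - i - e)^2 - 1/4 + x j]: for [j = i] the lowering contributes
   [1], otherwise [|j - i - e| >= 2/3]. *)
- have xj : 0 <= (x j)%:R :> R by [].
  have := arc_bounds k; rewrite /arc_abscissa; set e := _^-1 => e01.
  have [->|ji] := eqVneq j i; first by rewrite xi/=; nra.
  by case: (dist_ge ji) => ?; nra.
- have := arc_bounds k; rewrite /arc_abscissa; set e := _^-1 => e01.
  have : 0 <= e * L by rewrite mulr_ge0; lra.
  have := sqr_ge0 e; lra.
(* The gap is [(1 - 2 e) L + e^2 - 1/4], and [e <= 1/3], [L >= 1] make the first term at least
   [1/3]. *)
- have := arc_bounds k; rewrite /arc_abscissa; set e := _^-1 => e01.
  have : 0 <= (1 / 3 - e) * (L - 1) by rewrite mulr_ge0; lra.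
  have := sqr_ge0 e; lra.
have : 0 < (arc_abscissa i l - arc_abscissa i k) ^+ 2.
  rewrite exprn_even_gt0//= subr_eq0; apply: contra lk => /eqP lk.
  by rewrite /arc_point lk.
lra.
Qed.

End index_streams.

(** * From streaming algorithms to INDEX protocols *)

Lemma probability_setC_le d (T : measurableType d) (R : realType)
    (P : probability T R) (A : set T) (rho : R) :
  measurable A -> ((1 - rho)%:E <= P A)%E -> (P (~` A) <= rho%:E)%E.
Proof.
move=> mA; rewrite probability_setC// -(fineK (fin_num_measure P A mA)).
by rewrite !lee_fin; lra.
Qed.

Lemma index_streaming_bound (R : realType) (rho : R) (n C m N s : nat) (c : R)
    (A : streaming_algorithm R 'rV[R]_2 s) :
  0 <= rho -> rho < 1 / 2 -> (3 <= C)%N -> (m + N.+2)%N = n ->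
  c * n%:R <= N%:R -> distinguishes_hulls A rho n C c ->
  ((1 - expR (- (1 / 2 - rho))) / 2 - (1 / 2 - rho) * rho) * m%:R <= s%:R.
Proof.
move=> rho0 rho2 C3 mNn cN Adist.
pose stream (x : {ffun 'I_m -> bool}) (i : 'I_m) :=
  alice_stream R x ++ bob_stream R N i.
pose wrong (j : {ffun 'I_m -> bool} * 'I_m) : set (seed A) :=
  [set w | answer w (stream j.1 j.2) != j.1 j.2].
have mans P : measurable [set w : seed A | answer w P].
  exact: measurable_output.
have wrong_prob j : measurable (wrong j) /\ (seed_law A (wrong j) <= rho%:E)%E.
  case: j => x i; rewrite /wrong/=.
  have [|small large] := Adist (stream x i).
    by rewrite size_cat size_alice_stream size_bob_stream.
  case xi: (x i).
  - have -> : [set w : seed A | answer w (stream x i) != true]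
        = ~` [set w | answer w (stream x i)].
      by apply/seteqP; split => w /=; rewrite eqb_id => /negP.
    split; first exact: measurableC.
    apply: probability_setC_le => //; apply: large.
    by apply: le_trans cN _; rewrite ler_nat hull_size_large.
  - have -> : [set w : seed A | answer w (stream x i) != false]
        = ~` [set w | ~~ answer w (stream x i)].
      by apply/seteqP; split => w /=; rewrite eqbF_neg => /negP.
    have mN : measurable [set w : seed A | ~~ answer w (stream x i)].
      rewrite (_ : mkset _ = ~` [set w | answer w (stream x i)]).
        exact: measurableC.
      by apply/seteqP; split => w /= /negP.
    split; first exact: measurableC.
    apply: probability_setC_le => //; apply: small.
    by apply: leq_trans C3; exact: hull_size_small.
have [w few] := exists_few_events rho0 (fun j => (wrong_prob j).1)
  (fun j => (wrong_prob j).2).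
pose msg (x : {ffun 'I_m -> bool}) :=
  run (update w) 0%N (init_state w) (alice_stream R x).
(* Bob resumes at position [m], which is the length of Alice's stream for every [x]. *)
pose dec a (i : 'I_m) := output w (run (update w) m a (bob_stream R N i)).
have ansE x i : answer w (stream x i) = dec (msg x) i.
  by rewrite /answer run_cat add0n size_alice_stream.
rewrite -ler_expR.
apply: le_trans (@index_code_bound _ _ _ msg dec rho (1 / 2 - rho) _ _) _.
- by lra.
- apply: le_trans few; apply: ler_sum => -[x i] _ /=.
  rewrite -ansE ler_nat; case: (boolP (_ != _)) => // wrong_w.
  by rewrite mem_set.
(* There are [2 ^ s] messages, and [2 <= expR 1]. *)
rewrite card_tuple card_bool natrX -[s%:R]mulr1 expRM_natl.
rewrite lerXn2r ?nnegrE ?expR_ge0//.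
by have := @expR_ge1Dx R 1; lra.
Qed.

Theorem theorem8 (R : realType) (rho : R) (C : nat) (c : R)
    (rho_gt0 : 0 < rho) (rho_lt_half : rho < 1 / 2)
    (C_ge3 : (3 <= C)%N) (c_gt0 : 0 < c) (c_lt1 : c < 1) :
  exists delta : R, 0 < delta /\
  exists n0 : nat, forall n : nat, (n0 <= n)%N ->
  forall (s : nat) (A : streaming_algorithm R 'rV[R]_2 s),
    distinguishes_hulls A rho n C c -> delta * n%:R <= s%:R.
Proof.
have := index_rate_gt0 rho_lt_half; set kappa := (X in 0 < X) => kappa_gt0.
exists (kappa * ((1 - c) / 4)); split; first by rewrite mulr_gt0//; lra.
(* Past this threshold [(1 - c) n >= 4]. With [m] the integer part of [(1 - c) n / 2], this absorbs
   both the rounding, giving [m >= (1 - c) n / 4], and the two base points, leaving at least [c n]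
   points for the arc. *)
exists (Num.truncn (4 / (1 - c))).+1 => n n0n s A Adist.
have n4 : 4 <= (1 - c) * n%:R.
  rewrite mulrC -ler_pdivrMr; last by lra.
  have := truncnS_gt (4 / (1 - c)).
  have : (Num.truncn (4 / (1 - c))).+1%:R <= n%:R :> R by rewrite ler_nat.
  lra.
have cn0 : 0 <= (1 - c) / 2 * n%:R by rewrite mulr_ge0//; lra.
have := truncn_itv cn0; set m := Num.truncn _ => /andP[m_le].
rewrite -[m.+1%:R]natr1 => m_gt.
have m2n : (m.+2 <= n)%N.
  rewrite -(ler_nat R) -natr1 -natr1.
  by have : 0 <= c * n%:R; [rewrite mulr_ge0// ltW|lra].
have mNn : (m + (n - m.+2).+2)%N = n by rewrite !addnS -!addSn subnKC.
apply: le_trans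
  (index_streaming_bound (ltW rho_gt0) rho_lt_half C_ge3 mNn _ Adist).
  by rewrite -/kappa -mulrA ler_pM2l//; lra.
by rewrite natrB// -natr1 -natr1; lra.
Qed.
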